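(* Let $P\subset\mathbb{R}^k$ be a polytope. Then $\operatorname{ic}(P)\geqslant 2\sqrt{\operatorname{trdeg}(P)}-k$.
   Context: For a polytope $P\subset\mathbb{R}^d$, $\mathbb{Q}(P)$ is the field obtained from $\mathbb{Q}$ by adjoining all coordinates of all vertices of $P$, and $\operatorname{trdeg}(P)$ is the transcendence degree of $\mathbb{Q}(P)$ over $\mathbb{Q}$. For polytopes $P\subset\mathbb{R}^d$ and $Q\subset\mathbb{R}^N$ ($N\geqslant d$), $P$ is a slice of $Q$ if $P\times\{0\}=Q\cap H$ where $H=\{x\in\mathbb{R}^N: x_{d+1}=\cdots=x_N=0\}$. The intersection complexity $\operatorname{ic}(P)$ is the smallest integer $k$ such that $P$ is a slice of a polytope with $k$ vertices. *)

(* Defs.v *)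
From Stdlib Require Import Reals QArith List.
Import ListNotations.
Open Scope R_scope.

(* Points of R^d are represented as functions nat -> R that vanish at every
   index >= d (zero extension).  With this convention P x {0} subset R^N is
   literally the same set of functions as P subset R^d. *)
Definition point := nat -> R.

Definition in_Rd (d : nat) (x : point) : Prop := forall i, (d <= i)%nat -> x i = 0.

Definition in_hull (S : list point) (x : point) : Prop :=
  exists w : list R,
    length w = length S /\ Forall (fun a => 0 <= a) w /\
    fold_right Rplus 0 w = 1 /\
    forall i, x i = fold_right Rplus 0 (map (fun p => fst p * snd p i) (combine w S)).

Definition is_polytope (d : nat) (P : point -> Prop) : Prop :=
  exists S : list point, Forall (in_Rd d) S /\ forall x, P x <-> in_hull S x.

Definition is_vertex (P : point -> Prop) (v : point) : Prop :=
  P v /\ forall a b : point, P a -> P b ->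
    (exists t, 0 < t < 1 /\ forall i, v i = t * a i + (1 - t) * b i) ->
    a = v /\ b = v.

Definition num_vertices (Q : point -> Prop) (m : nat) : Prop :=
  exists l : list point, NoDup l /\ length l = m /\ forall v, In v l <-> is_vertex Q v.

Definition is_slice (d : nat) (P : point -> Prop) (N : nat) (Q : point -> Prop) : Prop :=
  (d <= N)%nat /\ is_polytope N Q /\
  forall x, P x <-> (Q x /\ forall i, (d <= i)%nat -> x i = 0).

Definition is_ic (d : nat) (P : point -> Prop) (n : nat) : Prop :=
  (exists N Q, is_slice d P N Q /\ num_vertices Q n) /\
  forall m N Q, is_slice d P N Q -> num_vertices Q m -> (n <= m)%nat.

Fixpoint exps (m D : nat) : list (list nat) :=
  match m with
  | O => [[]]
  | S m' => flat_map (fun e => map (fun j => j :: e) (seq 0 (S D))) (exps m' D)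
  end.

Definition monom (xs : list R) (e : list nat) : R :=
  fold_right Rmult 1 (map (fun p => fst p ^ snd p) (combine xs e)).

Definition peval (xs : list R) (D : nat) (c : list nat -> Q) : R :=
  fold_right Rplus 0 (map (fun e => Q2R (c e) * monom xs e) (exps (length xs) D)).

Definition alg_indep (xs : list R) : Prop :=
  forall (D : nat) (c : list nat -> Q), peval xs D c = 0 ->
    forall e, In e (exps (length xs) D) -> (c e == 0)%Q.

Definition in_field (G : R -> Prop) (y : R) : Prop :=
  exists gens : list R, Forall G gens /\
  exists (D : nat) (c1 c2 : list nat -> Q),
    peval gens D c2 <> 0 /\ y = peval gens D c1 / peval gens D c2.

Definition is_trdeg (G : R -> Prop) (t : nat) : Prop :=
  (exists xs, length xs = t /\ Forall (in_field G) xs /\ alg_indep xs) /\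
  forall xs, Forall (in_field G) xs -> alg_indep xs -> (length xs <= t)%nat.

Definition vertex_coord (d : nat) (P : point -> Prop) (y : R) : Prop :=
  exists v, is_vertex P v /\ exists i, (i < d)%nat /\ y = v i.

(* Main.v *)
Require Import Defs.
From Stdlib Require Import Reals QArith Qreals List.
From mathcomp Require Import all_boot all_order all_algebra.
From mathcomp Require Import boolp Rstruct.
From mathcomp Require Import ring lra zify.
Import Order.TTheory GRing.Theory Num.Theory.

(* Let Q be a polytope with n vertices and P its slice by a coordinate subspace.
   Then P = { w A : w >= 0, sum w = 1, w B = 0 }, where A and B contain the first k
   and the remaining coordinates of the vertices of Q.  If r = dim ker B, the vertices
   of P depend only on the point ker B of a Grassmannian and on the restriction of A
   to ker B, and their coordinates are rational functions of the corresponding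
   r (n - r) + r k parameters.  This bounds the transcendence degree by
   r (n + k - r) <= ((n + k) / 2) ^ 2. *)

Set Implicit Arguments.
Unset Strict Implicit.
Unset Printing Implicit Defensive.

Local Open Scope ring_scope.

(** * Subfields as predicates, and linear algebra with entries in them *)

Record is_subfield (K : fieldType) (S : K -> Prop) : Prop := IsSubfield {
  subfield1 : S 1;
  subfieldB : forall x y, S x -> S y -> S (x - y);
  subfieldM : forall x y, S x -> S y -> S (x * y);
  subfieldV : forall x, S x -> S x^-1
}.

Section Subfield.
Variables (K : fieldType) (S : K -> Prop).
Hypothesis HS : is_subfield S.

Lemma subfield0 : S 0.
Proof. by rewrite -(subrr 1); apply: (subfieldB HS); apply: (subfield1 HS). Qed.

Lemma subfieldN x : S x -> S (- x).
Proof. by move=> Sx; rewrite -sub0r; apply: (subfieldB HS) => //; apply: subfield0. Qed.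

Lemma subfieldD x y : S x -> S y -> S (x + y).
Proof.
by move=> Sx Sy; rewrite -[y]opprK; apply: (subfieldB HS) => //; apply: subfieldN.
Qed.

Lemma subfield_sum (J : Type) (r : seq J) (P : pred J) (F : J -> K) :
  (forall j, P j -> S (F j)) -> S (\sum_(j <- r | P j) F j).
Proof. by move=> SF; apply: big_ind => //; [exact: subfield0 | exact: subfieldD]. Qed.

Lemma subfield_prod (J : Type) (r : seq J) (P : pred J) (F : J -> K) :
  (forall j, P j -> S (F j)) -> S (\prod_(j <- r | P j) F j).
Proof.
by move=> SF; apply: big_ind => //; [exact: subfield1 HS | exact: subfieldM HS].
Qed.

Lemma subfieldX x n : S x -> S (x ^+ n).
Proof.
move=> Sx; elim: n => [|n IHn]; first exact: subfield1 HS.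
by rewrite exprS; apply: (subfieldM HS).
Qed.

Lemma subfield_nat n : S n%:R.
Proof.
elim: n => [|n IHn]; first exact: subfield0.
by rewrite -natr1; apply: subfieldD => //; apply: subfield1 HS.
Qed.

Lemma subfield_det n (A : 'M[K]_n) : (forall i j, S (A i j)) -> S (\det A).
Proof.
move=> SA; apply: subfield_sum => s _; apply: (subfieldM HS).
  by apply: subfieldX; apply: subfieldN; apply: subfield1 HS.
by apply: subfield_prod.
Qed.

Lemma subfield_mulmx m n p (A : 'M[K]_(m, n)) (B : 'M_(n, p)) :
  (forall i j, S (A i j)) -> (forall i j, S (B i j)) ->
  forall i j, S ((A *m B) i j).
Proof.
by move=> SA SB i j; rewrite mxE; apply: subfield_sum => l _; apply: (subfieldM HS).
Qed.

Lemma subfield_invmx n (A : 'M[K]_n) :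
  (forall i j, S (A i j)) -> forall i j, S (invmx A i j).
Proof.
(* By convention [invmx] fixes a singular matrix; otherwise it is given by cofactors over the
   determinant. *)
move=> SA i j; rewrite /invmx; case: ifP => // _.
rewrite !mxE; apply: (subfieldM HS); first by apply: (subfieldV HS); apply: subfield_det.
apply: (subfieldM HS); first by apply: subfieldX; apply: subfieldN; apply: subfield1 HS.
by apply: subfield_det => i' j'; rewrite !mxE.
Qed.

(** Some columns of [T] form an invertible square matrix, so Cramer's rule recovers [y] from the
    matching entries of [y *m T]. The entries of [y] are only known to lie in the ambient field
    beforehand. *)
Lemma subfield_row_solution m n (y : 'rV[K]_m) (T : 'M_(m, n)) :
  row_free T -> (forall i j, S (T i j)) ->
  (forall j, S ((y *m T) 0 j)) -> forall i, S (y 0 i).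
Proof.
move=> freeT ST SyT i.
have fullT : row_full T^T by rewrite /row_full mxrank_tr.
set f := fullrankfun fullT.
have unitTf : (rowsub f T^T)^T \in unitmx by rewrite unitmx_tr fullrowsub_unit.
have -> : y = colsub f (y *m T) *m invmx (rowsub f T^T)^T.
  rewrite -mulmx_colsub.
  suff -> : colsub f T = (rowsub f T^T)^T by rewrite mulmxK.
  by apply/matrixP => a b; rewrite !mxE.
apply: subfield_mulmx => [a b|]; first by rewrite ord1 mxE.
by apply: subfield_invmx => a b; rewrite !mxE.
Qed.

End Subfield.

(** * Rational functions of finitely many parameters and their transcendence degree *)

Section Fractions.
Variables (K : numFieldType) (I : finType) (z : I -> K).

(* The degree bound is in each variable separately. *)
Definition rat_poly (D : nat) (y : K) : Prop :=
  exists c : {ffun I -> 'I_D.+1} -> rat,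
    y = \sum_e ratr (c e) * \prod_i z i ^+ e i.

Lemma rat_polyD D x y : rat_poly D x -> rat_poly D y -> rat_poly D (x + y).
Proof.
move=> [c ->] [d ->]; exists (fun e => c e + d e).
by rewrite -big_split; apply: eq_bigr => e _; rewrite rmorphD mulrDl.
Qed.

Lemma rat_polyZ D q y : rat_poly D y -> rat_poly D (ratr q * y).
Proof.
move=> [c ->]; exists (fun e => q * c e).
by rewrite mulr_sumr; apply: eq_bigr => e _; rewrite rmorphM mulrA.
Qed.

Lemma rat_poly_mon D (e : I -> nat) :
  (forall i, (e i <= D)%N) -> rat_poly D (\prod_i z i ^+ e i).
Proof.
move=> leeD; pose e' : {ffun I -> 'I_D.+1} := [ffun i => inord (e i)].
exists (fun f => (f == e')%:R); rewrite [RHS](bigD1 e') //= eqxx rmorph1 mul1r.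
rewrite [X in _ + X]big1 ?addr0; last by move=> f fe; rewrite (negPf fe) rmorph0 mul0r.
by apply: eq_bigr => i _; rewrite ffunE inordK ?ltnS.
Qed.

Lemma rat_poly_rat D q : rat_poly D (ratr q).
Proof.
rewrite -[ratr q]mulr1; apply: rat_polyZ.
suff -> : 1 = \prod_i z i ^+ 0 by apply: rat_poly_mon.
by rewrite big1.
Qed.

Lemma rat_poly_sum D (J : Type) (r : seq J) (F : J -> K) :
  (forall j, rat_poly D (F j)) -> rat_poly D (\sum_(j <- r) F j).
Proof.
move=> FD; apply: big_ind => //; last exact: rat_polyD.
by rewrite -(rmorph0 (ratr : rat -> K)); apply: rat_poly_rat.
Qed.

Lemma rat_polyM D E x y :
  rat_poly D x -> rat_poly E y -> rat_poly (D + E) (x * y).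
Proof.
move=> [c ->] [d ->]; rewrite mulr_suml; apply: rat_poly_sum => e.
rewrite mulr_sumr; apply: rat_poly_sum => f.
rewrite mulrACA -rmorphM -big_split /=; apply: rat_polyZ.
under eq_bigr => i _ do rewrite -exprD.
by apply: rat_poly_mon => i; rewrite leq_add // -ltnS.
Qed.

Lemma rat_poly_var i : rat_poly 1 (z i).
Proof.
rewrite (_ : z i = \prod_j z j ^+ (j == i)); last first.
  by rewrite (bigD1 i) //= eqxx big1 ?mulr1 // => j /negPf ->.
by apply: rat_poly_mon => j; case: (j == i).
Qed.

Lemma rat_polyX D n x : rat_poly D x -> rat_poly (n * D) (x ^+ n).
Proof.
move=> xD; elim: n => [|n IHn].
  by rewrite expr0 -(rmorph1 (ratr : rat -> K)); apply: rat_poly_rat.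
by rewrite exprS mulSn; apply: rat_polyM.
Qed.

Lemma rat_poly_prod t D (F : 'I_t -> K) :
  (forall j, rat_poly D (F j)) -> rat_poly (t * D) (\prod_j F j).
Proof.
elim: t F => [|t IHt] F FD.
  by rewrite big_ord0 -(rmorph1 (ratr : rat -> K)); apply: rat_poly_rat.
by rewrite big_ord_recl mulSn; apply: rat_polyM => //; apply: IHt => j; apply: FD.
Qed.

Definition rat_frac (y : K) : Prop :=
  exists D a b, [/\ rat_poly D a, rat_poly D b, b != 0 & y = a / b].

Lemma rat_frac_var i : rat_frac (z i).
Proof.
exists 1%N, (z i), 1; rewrite divr1 oner_eq0; split=> //.
  exact: rat_poly_var.
by rewrite -(rmorph1 (ratr : rat -> K)); apply: rat_poly_rat.
Qed.

Lemma rat_frac_subfield : is_subfield rat_frac.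
Proof.
split.
- exists 0%N, 1, 1; rewrite divr1 oner_eq0 -(rmorph1 (ratr : rat -> K)).
  by split=> //; apply: rat_poly_rat.
- move=> _ _ [D [a [b [aD bD b0 ->]]]] [E [c [d [cE dE d0 ->]]]].
  exists (D + E)%N, (a * d + (ratr (-1) * b) * c), (b * d); split.
  + by apply: rat_polyD; apply: rat_polyM => //; apply: rat_polyZ.
  + exact: rat_polyM.
  + by rewrite mulf_neq0.
  + by rewrite rmorphN1; field; rewrite b0 d0.
- move=> _ _ [D [a [b [aD bD b0 ->]]]] [E [c [d [cE dE d0 ->]]]].
  exists (D + E)%N, (a * c), (b * d); rewrite mulf_neq0 // mulf_div.
  by split=> //; apply: rat_polyM.
(* Since the inverse of 0 is 0, a zero numerator is handled separately, by the fraction 0/1. *)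
- move=> _ [D [a [b [aD bD b0 ->]]]]; have [->|a0] := eqVneq a 0.
    exists 0%N, (ratr 0), (ratr 1); split; try exact: rat_poly_rat.
      by rewrite rmorph1 oner_eq0.
    by rewrite rmorph0 !mul0r invr0.
  by exists D, b, a; split; rewrite // invf_div.
Qed.

Lemma rat_frac_common_denominator (xs : seq K) :
  (forall x, x \in xs -> rat_frac x) ->
  exists D q, [/\ q != 0, rat_poly D q & forall x, x \in xs -> rat_poly D (x * q)].
Proof.
elim: xs => [|x xs IHxs] xsF.
  exists 0%N, (ratr 1); split=> //; last exact: rat_poly_rat.
  by rewrite rmorph1 oner_eq0.
have [y yxs|D [q [q0 qD xsD]]] := IHxs; first by apply: xsF; rewrite inE yxs orbT.
have [E [a [b [aE bE b0 xE]]]] := xsF x (mem_head _ _).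
exists (D + E)%N, (q * b); split; first by rewrite mulf_neq0.
  exact: rat_polyM.
move=> y; rewrite inE => /predU1P[->|yxs]; last first.
  by rewrite mulrA; apply: rat_polyM => //; apply: xsD.
rewrite (_ : x * (q * b) = q * a); first exact: rat_polyM.
by rewrite xE; field.
Qed.

(** The coefficient vectors of the [v j] live in a rational space of dimension [W.+1 ^ #|I|], so
    they satisfy a nontrivial linear relation, which persists after evaluation at [z], whether or
    not the [z i] are independent. *)
Lemma rat_poly_dependent (J : finType) (v : J -> K) W :
  (forall j, rat_poly W (v j)) -> (W.+1 ^ #|I| < #|J|)%N ->
  exists c : J -> rat, (exists j, c j != 0) /\ \sum_j ratr (c j) * v j = 0.
Proof.
move=> vW ltWJ; have [C CE] := fin_all_exists vW.
pose A : 'M[rat]_(#|J|, #|{ffun I -> 'I_W.+1}|) :=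
  \matrix_(i, j) C (enum_val i) (enum_val j).
have /rowV0Pn[u /sub_kermxP uA u0] : kermx A != 0.
  rewrite kermx_eq0 /row_free neq_ltn (leq_ltn_trans (rank_leq_col A)) //.
  by rewrite card_ffun card_ord.
exists (fun j => u 0 (enum_rank j)); split.
  by have /rV0Pn[i ui] := u0; exists (enum_val i); rewrite enum_valK.
under eq_bigr => j _ do rewrite CE mulr_sumr.
rewrite exchange_big big1 //= => e _.
under eq_bigr => j _ do rewrite mulrA -rmorphM.
rewrite -mulr_suml -rmorph_sum (_ : \sum_i _ = 0) ?rmorph0 ?mul0r //.
have := congr1 (fun B : 'rV_ _ => B 0 (enum_rank e)) uA; rewrite !mxE; apply: etrans.
rewrite (reindex _ (onW_bij _ (enum_val_bij J))) /=.
by apply: eq_bigr => i _; rewrite mxE enum_valK enum_rankK.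
Qed.

Definition rat_alg_indep t (x : 'I_t -> K) : Prop :=
  forall E (c : {ffun 'I_t -> 'I_E.+1} -> rat),
    \sum_e ratr (c e) * \prod_i x i ^+ e i = 0 -> forall e, c e = 0.

(* With a common denominator [q] of degree [D], the [(E+1)^t] monomials of
   degree at most [E] in each [x i], multiplied by [q ^ (t E)], lie in a rational
   vector space of dimension [(t E D + 1) ^ #|I|]; compare orders of growth
   in [E]. *)
Lemma rat_frac_trdeg t (x : 'I_t -> K) :
  (forall i, rat_frac (x i)) -> rat_alg_indep x -> (t <= #|I|)%N.
Proof.
move=> xF indx; rewrite leqNgt; apply/negP => ltIt.
have [y|D [q [q0 qD xD]]] := @rat_frac_common_denominator (codom x).
  by case/codomP => i ->.
(* With this [E], [((t * D).+1 * E.+1) ^ g = E * E.+1 ^ g], which is less than [E.+1 ^ g.+1] and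
   hence than [E.+1 ^ t]. *)
pose g := #|I|; pose E := ((t * D).+1 ^ g)%N.
have [||c [[e ce0] cE]] := @rat_poly_dependent {ffun 'I_t -> 'I_E.+1}
    (fun e => \prod_i (x i ^+ e i * q ^+ E)) (t * (E * D))%N.
- move=> e; apply: rat_poly_prod => i; have leeE : (e i <= E)%N by rewrite -ltnS.
  (* Group the factor as [(x i * q) ^+ d * q ^+ (E - d)], of degree at most
     [d * D + (E - d) * D]. *)
  move: (nat_of_ord _) leeE => d leeE; rewrite -(subnKC leeE) exprD.
  rewrite mulrA -exprMn mulnDl; apply: rat_polyM.
    by apply: rat_polyX; apply: xD; apply: codom_f.
  exact: rat_polyX.
- rewrite card_ffun !card_ord -/g.
  have le1 : ((t * (E * D)).+1 <= (t * D).+1 * E.+1)%N by nia.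
  apply: (@leq_ltn_trans (((t * D).+1 * E.+1) ^ g)%N).
    by case: (g) => [|g'] //; rewrite leq_exp2r.
  apply: (@leq_trans (E.+1 ^ g.+1)%N); last by rewrite leq_pexp2l.
  by rewrite expnMn expnS ltn_pmul2r ?expn_gt0.
- move/eqP: ce0; apply; apply: indx; apply/eqP.
  (* Cancelling the common power of [q] turns the linear relation into a polynomial relation between
     the [x i]. *)
  have qE0 : \prod_(i < t) q ^+ E != 0.
    by apply/prodf_neq0 => i _; rewrite expf_neq0.
  rewrite -(inj_eq (mulIf qE0)) mul0r; apply/eqP; apply: etrans cE.
  by rewrite mulr_suml; apply: eq_bigr => f _; rewrite -mulrA -big_split.
Qed.

End Fractions.

(** * Vertices of a slice in terms of convex weights *)

Section Slices.
Variables (R : realFieldType) (n k m : nat) (A : 'M[R]_(n, k)) (B : 'M[R]_(n, m)).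

Definition slice_weight (w : 'rV[R]_n) : Prop :=
  [/\ forall j, 0 <= w 0 j, \sum_j w 0 j = 1 & w *m B = 0].

(** Extremality concerns the images under [A], not the weights, because several weights may lie
    above one vertex. *)
Definition slice_vertex (v : 'rV[R]_k) : Prop :=
  (exists2 w, slice_weight w & w *m A = v) /\
  forall w1 w2 s, slice_weight w1 -> slice_weight w2 -> 0 < s < 1 ->
    v = s *: (w1 *m A) + (1 - s) *: (w2 *m A) -> w1 *m A = v.

(** The ratio test of the simplex method: a nonzero [u] of total 0 has a negative entry, and the
    least ratio [w 0 j / - u 0 j] over negative entries is the longest step keeping all weights
    nonnegative. It is positive because [u] is supported where [w] is. *)
Lemma slice_weight_step w u :
    slice_weight w -> u *m B = 0 -> (forall j, w 0 j = 0 -> u 0 j = 0) ->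
    \sum_j u 0 j = 0 -> u != 0 ->
  exists s, [/\ 0 < s, slice_weight (w + s *: u)
    & exists2 j, w 0 j != 0 & (w + s *: u) 0 j = 0].
Proof.
move=> [w0 w1 wB] uB uw u1 un0.
have [j0 uj0] : exists j, u 0 j < 0.
  apply/existsP; apply: contraR un0; rewrite negb_exists => /forallP u0.
  have {}u0 j : 0 <= u 0 j by rewrite leNgt.
  apply/eqP/rowP => j; rewrite mxE.
  by apply: (psumr_eq0P (P := xpredT) _ u1).
pose s_ j := w 0 j / - u 0 j.
have [j uj sj] : exists2 j, u 0 j < 0 & forall i, u 0 i < 0 -> s_ j <= s_ i.
  by case: (@arg_minP _ _ _ j0 (fun j => u 0 j < 0) s_) => // j; exists j.
have wjn0 : w 0 j != 0.
  by apply/eqP => /uw uj0'; move: uj; rewrite uj0' ltxx.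
have s0 : 0 < s_ j by rewrite divr_gt0 ?oppr_gt0 // lt0r wjn0 w0.
exists (s_ j); split=> //; last first.
  exists j => //; rewrite !mxE /s_ invrN mulrN mulNr divfK ?subrr //.
  by rewrite lt_eqF.
split=> [i||].
- rewrite !mxE; have [ui|ui] := ltP (u 0 i) 0; last first.
    by rewrite addr_ge0 // mulr_ge0 // ltW.
  have := sj i ui; rewrite /s_ ler_pdivlMr ?oppr_gt0 // mulrN.
  by move: (_ * u 0 i) => x; lra.
- under eq_bigr => i _ do rewrite !mxE.
  by rewrite big_split /= w1 -mulr_sumr u1 mulr0 addr0.
- by rewrite mulmxDl wB -scalemxAl uB scaler0 addr0.
Qed.

(* A weight vector of minimal support above a vertex [v]: a second direction [u]
   could be followed both ways until a weight vanishes, and by extremality the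
   end points would still lie above [v]. *)
Lemma slice_vertex_rigid v :
  slice_vertex v ->
  exists w, [/\ slice_weight w, w *m A = v
    & forall u, u *m B = 0 -> (forall j, w 0 j = 0 -> u 0 j = 0) ->
        u = (\sum_j u 0 j) *: w].
Proof.
move=> [[w wP wv] ext]; pose supp (w : 'rV[R]_n) := #|[set j | w 0 j != 0]|.
have [d] := ubnP (supp w); elim: d w wP wv => // d IHd w wP wv suppw.
have [w0 w1 wB] := wP.
case: (pselect (forall u, u *m B = 0 -> (forall j, w 0 j = 0 -> u 0 j = 0) ->
        u = (\sum_j u 0 j) *: w)) => [|/existsNP[u /not_implyP[uB /not_implyP[uw /eqP]]]].
  by exists w.
(* Subtracting the multiple of [w] with the same total gives a nonzero direction of total 0 in the
   kernel of [B]. *)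
rewrite -subr_eq0; set u' := u - _ => u'n0.
have u'B : u' *m B = 0 by rewrite mulmxBl uB -scalemxAl wB scaler0 subr0.
have u'w j : w 0 j = 0 -> u' 0 j = 0.
  by move=> wj; rewrite !mxE wj mulr0 (uw _ wj) subr0.
have u'1 : \sum_j u' 0 j = 0.
  under eq_bigr => j _ do rewrite !mxE.
  by rewrite sumrB -mulr_sumr w1 mulr1 subrr.
clearbody u'; have [s [s0 sP [j wj sj]]] := slice_weight_step wP u'B u'w u'1 u'n0.
have [||||t [t0 tP _]] := @slice_weight_step w (- u') wP.
- by rewrite mulNmx u'B oppr0.
- by move=> i wi; rewrite mxE u'w ?oppr0.
- by under eq_bigr => i _ do rewrite mxE; rewrite sumrN u'1 oppr0.
- by rewrite oppr_eq0.
have st0 : s + t != 0 by rewrite gt_eqF // addr_gt0.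
(* The coefficients [t / (s + t)] and [s / (s + t)] make the two end points [w + s *: u'] and
   [w - t *: u'] average to [w]. *)
apply: (IHd (w + s *: u')) => //.
  apply: (ext _ _ (t / (s + t)) sP tP).
    by rewrite divr_gt0 ?addr_gt0 // ltr_pdivrMr ?addr_gt0 // mul1r ltrDr.
  rewrite -wv !scalemxAl -mulmxDl; congr (_ *m A).
  by apply/rowP => i; rewrite !mxE; field.
rewrite ltnS in suppw; apply: leq_trans suppw; apply: proper_card; apply/properP; split.
  apply/subsetP => i; rewrite !inE; apply: contra => /eqP wi.
  by rewrite !mxE wi (u'w _ wi) mulr0 addr0.
by exists j; rewrite inE // sj eqxx.
Qed.

(* The parameters are the coordinates of [ker B] in the affine chart of the
   Grassmannian given by the pivots [f], and the matrix of [A] on [ker B]. *)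
Lemma slice_vertices_rat_frac :
  exists r (I : finType) (z : I -> R),
    [/\ (r <= n)%N, #|I| = (r * (n - r) + r * k)%N
      & forall v, slice_vertex v -> forall i, rat_frac z (v 0 i)].
Proof.
pose N := row_base (kermx B); pose r := \rank (kermx B).
have fullN : row_full N^T by rewrite /row_full mxrank_tr -/(row_free _) row_base_free.
pose f := fullrankfun fullN; have f_inj : injective f by apply: fullrankfun_inj.
pose U := (rowsub f N^T)^T.
have unitU : U \in unitmx by rewrite unitmx_tr fullrowsub_unit.
(* The basis of the kernel that is the identity on the pivot columns, so that only [r * (n - r)]
   entries are free and a kernel vector is determined by its pivot entries. *)
pose M := invmx U *m N.
have colM : colsub f M = 1%:M.
  rewrite -mulmx_colsub (_ : colsub f N = U) ?mulVmx //.
  by apply/matrixP => a b; rewrite !mxE.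
have MB : M *m B = 0.
  have /sub_kermxP NB : (N <= kermx B)%MS by rewrite eq_row_base.
  by rewrite -mulmxA NB mulmx0.
have kerM u : u *m B = 0 -> u = colsub f u *m M.
  move=> uB; have /submxP[y uy] : (u <= N)%MS by rewrite eq_row_base; apply/sub_kermxP.
  rewrite {2}uy -mulmx_colsub (_ : colsub f N = U); last first.
    by apply/matrixP => a b; rewrite !mxE.
  by rewrite mulmxA mulmxK.
pose I := (('I_r * {j : 'I_n | j \notin codom f}) + ('I_r * 'I_k))%type.
pose z (x : I) := match x with
  | inl (i, j) => M i (val j) | inr (i, j) => (M *m A) i j end.
have SF := rat_frac_subfield z; exists r, I, z; split; first exact: rank_leq_col.
  rewrite card_sum !card_prod !card_ord card_sig; congr (_ * _ + _)%N.
  have := cardC (mem (codom f)); rewrite card_codom // !card_ord => /(canRL (addKn _)) <-.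
  by apply: eq_card => j; rewrite !inE.
have SM i j : rat_frac z (M i j).
  have [/codomP[i' ->]|jf] := boolP (j \in codom f).
    have := congr1 (fun X : 'M_r => X i i') colM; rewrite !mxE => ->.
    by case: eqP => _; [exact: subfield1 SF | exact: subfield0 SF].
  exact: (rat_frac_var z (inl (i, Sub j jf))).
move=> v /slice_vertex_rigid[w [[w0 w1 wB] <- rigid]] i.
(* As [v = y *m (M *m A)] and the entries of [M *m A] are parameters, it is enough to show that [y]
   is rational in them. *)
pose y := colsub f w; have wE : w = y *m M by apply: kerM.
rewrite wE -mulmxA mxE; apply: (subfield_sum SF) => l _.
apply: (subfieldM SF); last exact: (rat_frac_var z (inr (l, i))).
(* A linear system for [y] over the parameter field: [y *m M] vanishes off the support of [w], and
   its entries sum to 1. Columns of the support are filled with zeros. *)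
pose T : 'M_(r, n + 1) := row_mx (\matrix_(a, j) if w 0 j == 0 then M a j else 0)
  (\col_a \sum_j M a j).
have yTl (x : 'rV_r) j : (x *m T) 0 (lshift 1 j) = if w 0 j == 0 then (x *m M) 0 j else 0.
  rewrite mul_mx_row row_mxEl !mxE; case: eqP => wj.
    by apply: eq_bigr => a _; rewrite mxE wj eqxx.
  by rewrite big1 // => a _; rewrite mxE; case: eqP => //; rewrite mulr0.
have yTr (x : 'rV_r) : (x *m T) 0 (rshift n 0) = \sum_j (x *m M) 0 j.
  rewrite mul_mx_row row_mxEr mxE.
  under eq_bigr => a _ do rewrite mxE mulr_sumr.
  by rewrite exchange_big; apply: eq_bigr => j _; rewrite mxE.
apply: (subfield_row_solution SF (T := T)).
(* Rigidity makes the solution unique: if [x *m T = 0], then [x *m M] is [w] scaled by its total,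
   which is 0, and the pivot columns give [x = 0]. *)
- apply: inj_row_free => x xT.
  have xM : x *m M = 0.
    rewrite (rigid (x *m M)) -?yTr ?xT ?mxE ?scale0r //.
      by rewrite -mulmxA MB mulmx0.
    by move=> j wj; have := yTl x j; rewrite wj eqxx xT mxE.
  by rewrite -[x]mulmx1 -colM mulmx_colsub xM; apply/rowP => j; rewrite !mxE.
- move=> a b; rewrite mxE; case: splitP => c _; rewrite mxE.
    by case: eqP => _; [exact: SM | exact: subfield0 SF].
  by apply: (subfield_sum SF) => j _; apply: SM.
- move=> c; rewrite -[c]splitK; case: (split c) => c' /=.
    by rewrite yTl -wE; case: eqP => [->|_]; apply: (subfield0 SF).
  by rewrite ord1 yTr -wE w1; apply: (subfield1 SF).
Qed.

End Slices.

(** * Convex hulls of lists and their vertices *)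

Definition origin : point := fun=> 0.

Lemma In_seq_nth (T : Type) (x0 : T) (l : seq T) i : (i < size l)%N -> In (nth x0 l i) l.
Proof. by elim: l i => // a l IHl [|i] /=; [left | move=> /IHl; right]. Qed.

(** Weights indexed by ordinals give access to big operators and row vectors. *)
Lemma in_hullE S x :
  in_hull S x <-> exists w : 'I_(size S) -> R,
    [/\ forall i, 0 <= w i, \sum_i w i = 1
      & forall j, x j = \sum_i w i * nth origin S i j].
Proof.
have sumE (w : seq R) : fold_right Rplus 0 w = \sum_(i < size w) w`_i.
  by elim: w => [|a w IHw]; rewrite ?big_ord0 // big_ord_recl /= IHw.
have combE (w : seq R) T j : size w = size T ->
    fold_right Rplus 0 (List.map (fun p => Rmult p.1 (p.2 j)) (combine w T)) =
    \sum_(i < size T) w`_i * nth origin T i j.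
  elim: w T => [|a w IHw] [|b T] //=; rewrite ?big_ord0 // => -[sz].
  by rewrite big_ord_recl /= IHw.
split=> [[w [sz [w0 [w1 xE]]]] | [w [w0 w1 xE]]].
  have {}sz : size w = size S by [].
  exists (fun i => w`_i); split=> [i||j]; last by rewrite xE combE.
    have /(In_seq_nth 0) wi : (i < size w)%N by rewrite sz.
    by apply/RleP; move/Forall_forall: w0; apply.
  by rewrite -sz -sumE w1.
have sz : size (codom w) = size S by rewrite size_codom card_ord.
have wE (i : 'I_(size S)) : (codom w)`_i = w i.
  by rewrite (nth_map i) ?size_enum_ord // nth_ord_enum.
exists (codom w); split=> //; split; last split.
- apply/Forall_forall => y /(in_map_iff w)[i [<- _]]; exact/RleP.
- by rewrite sumE sz -[RHS]w1; apply: eq_bigr => i _; rewrite wE.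
- move=> j; rewrite combE // xE; apply: eq_bigr => i _.
  by rewrite wE.
Qed.

Lemma in_hull_In S s : In s S -> in_hull S s.
Proof.
move=> sS; apply/in_hullE.
have [i si] : exists i : 'I_(size S), nth origin S i = s.
  elim: S sS => //= a S IHS [->|/IHS[i si]]; first by exists ord0.
  by exists (lift ord0 i).
exists (fun l => (l == i)%:R); split=> [l||j]; first exact: ler0n.
  by rewrite (bigD1 i) //= eqxx big1 ?addr0 // => l /negPf ->.
rewrite (bigD1 i) //= eqxx mul1r si big1 ?addr0 // => l /negPf ->.
by rewrite mul0r.
Qed.

Lemma in_hull_trans S S' x :
  (forall s, In s S -> in_hull S' s) -> in_hull S x -> in_hull S' x.
Proof.
move=> SS' /in_hullE[w [w0 w1 xE]].
have /fin_all_exists[W WP] : forall i : 'I_(size S), exists w' : 'I_(size S') -> R,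
    [/\ forall l, 0 <= w' l, \sum_l w' l = 1
      & forall j, nth origin S i j = \sum_l w' l * nth origin S' l j].
  by move=> i; apply/in_hullE/SS'/In_seq_nth.
apply/in_hullE; exists (fun l => \sum_i w i * W i l); split=> [l||j].
- by apply: sumr_ge0 => i _; apply: mulr_ge0 => //; case: (WP i).
- rewrite exchange_big -[RHS]w1; apply: eq_bigr => i _.
  by rewrite -mulr_sumr; case: (WP i) => _ -> _; rewrite mulr1.
- under [RHS]eq_bigr => l _ do rewrite mulr_suml.
  rewrite exchange_big xE; apply: eq_bigr => i _.
  case: (WP i) => _ _ ->; rewrite mulr_sumr.
  by apply: eq_bigr => l _; rewrite mulrA.
Qed.

Lemma in_hull_incl S S' x : incl S S' -> in_hull S x -> in_hull S' x.
Proof. by move=> SS'; apply: in_hull_trans => s /SS'; apply: in_hull_In. Qed.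

(** If [s] is a proper convex combination of [a] and [b], expanding both over [s :: S] gives [s]
    some weight [g] in its own expansion. If [g = 1], both points equal [s]; otherwise solving for
    [s], with the other weights divided by [1 - g], puts [s] in the hull of [S]. *)
Lemma in_hull_vertex S s : ~ in_hull S s -> is_vertex (in_hull (s :: S)) s.
Proof.
move=> sS; split=> [|a b]; first by apply: in_hull_In; left.
move=> /in_hullE[u [u0 u1 aE]] /in_hullE[v [v0 v1 bE]] [t [[/RltP t0 /RltP t1] sE]].
rewrite /= !big_ord_recl in u1 v1.
have {}aE j : a j = u ord0 * s j + \sum_(i < size S) u (lift ord0 i) * nth origin S i j.
  by rewrite aE big_ord_recl.
have {}bE j : b j = v ord0 * s j + \sum_(i < size S) v (lift ord0 i) * nth origin S i j.
  by rewrite bE big_ord_recl.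
have u00 := u0 ord0; have v00 := v0 ord0.
have usum : 0 <= \sum_(i < size S) u (lift ord0 i) by apply: sumr_ge0.
have vsum : 0 <= \sum_(i < size S) v (lift ord0 i) by apply: sumr_ge0.
rewrite R0E R1E in t0 t1.
pose g := t * u ord0 + (1 - t) * v ord0.
have [g1|gn1] := eqVneq g 1.
  have [u01 v01] : u ord0 = 1 /\ v ord0 = 1 by split; rewrite /g in g1; nra.
  have ui i : u (lift ord0 i) = 0.
    apply: (psumr_eq0P (P := xpredT) (F := fun i => u (lift ord0 i))) => //.
    by move: u1; rewrite u01; lra.
  have vi i : v (lift ord0 i) = 0.
    apply: (psumr_eq0P (P := xpredT) (F := fun i => v (lift ord0 i))) => //.
    by move: v1; rewrite v01; lra.
  split; apply: functional_extensionality_dep => j.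
    by rewrite aE u01 mul1r big1 ?addr0 // => i _; rewrite ui mul0r.
  by rewrite bE v01 mul1r big1 ?addr0 // => i _; rewrite vi mul0r.
have glt1 : 0 < 1 - g.
  by move: gn1; rewrite -subr_eq0 lt_def -oppr_eq0 opprB => -> /=; rewrite /g; nra.
case: sS; apply/in_hullE.
exists (fun i => (t * u (lift ord0 i) + (1 - t) * v (lift ord0 i)) / (1 - g)).
split=> [i||j].
- apply: divr_ge0; last exact: ltW.
  by apply: addr_ge0; apply: mulr_ge0; rewrite ?subr_ge0 // ltW.
- rewrite /= -mulr_suml big_split /= -!mulr_sumr.
  apply: (mulIf (lt0r_neq0 glt1)); rewrite divfK ?lt0r_neq0 // mul1r.
  move: u1 v1 => /(canRL (addKr _)) -> /(canRL (addKr _)) ->; rewrite /g; ring.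
- apply: (mulIf (lt0r_neq0 glt1)); rewrite /= mulr_suml.
  under eq_bigr => i _ do rewrite mulrAC divfK ?lt0r_neq0 // mulrDl -!mulrA.
  rewrite big_split /= -!mulr_sumr.
  have := sE j; rewrite aE bE !(RplusE, RmultE, RminusE) R1E /g => sj.
  rewrite mulrBr mulr1 {1}sj /g; ring.
Qed.

(** Points in the hull of the others are discarded one at a time; when none is left,
    [in_hull_vertex] makes every remaining point a vertex. *)
Lemma in_hull_irredundant S :
  exists S', [/\ incl S' S, NoDup S', forall x, in_hull S' x <-> in_hull S x
    & forall s, In s S' -> is_vertex (in_hull S) s].
Proof.
have [d] := ubnP (size S); elim: d S => // d IHd S; rewrite ltnS => leSd.
have [[l1 [s [l2 [SE sl]]]]|irr] := pselect (exists l1 s l2,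
    S = l1 ++ s :: l2 /\ in_hull (l1 ++ l2) s).
  have [|S' [S'l S'nd S'h S'v]] := IHd (l1 ++ l2).
    by move: leSd; rewrite SE !size_cat /= addnS.
  have lS : incl (l1 ++ l2) S.
    by move=> y; rewrite SE !in_app_iff => -[]; [left | right; right].
  have hE x : in_hull (l1 ++ l2) x <-> in_hull S x.
    split; first exact: in_hull_incl.
    apply: in_hull_trans => y; rewrite SE => /in_app_iff[yl1|[<- //|yl2]];
      by apply: in_hull_In; apply/in_app_iff; tauto.
  have hE' : in_hull (l1 ++ l2) = in_hull S.
    by apply: functional_extensionality_dep => x; apply: propext.
  by exists S'; split=> // [y /S'l /lS //||]; rewrite -hE'.
have sl l1 s l2 : S = l1 ++ s :: l2 -> ~ in_hull (l1 ++ l2) s.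
  by move=> SE sl; apply: irr; exists l1, s, l2.
exists S; split=> // [|s].
  (* A repeated point would lie in the hull of the others. *)
  suff ndT T l : S = l ++ T -> NoDup T by apply: (ndT _ [::]).
  elim: T l => [|s T IHT] l SE; constructor.
    by move=> sT; case: (sl _ _ _ SE); apply: in_hull_In; apply/in_app_iff; right.
  by apply: (IHT (l ++ [:: s])); rewrite -catA.
move=> sS; have [l1 [l2 SE]] := in_split _ _ sS.
have -> : in_hull S = in_hull (s :: l1 ++ l2).
  apply: functional_extensionality_dep => x; apply: propext; rewrite SE.
  split; apply: in_hull_incl => y; rewrite /= !in_app_iff /=; tauto.
exact/in_hull_vertex/sl/SE.
Qed.

(** * From list-based polynomials and fields to [rat_frac] and [rat_alg_indep] *)

Lemma subfield_peval (F : R -> Prop) (xs : seq R) D c :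
  is_subfield F -> (forall x, In x xs -> F x) -> F (peval xs D c).
Proof.
move=> HF xsF; have F_nat k : F (INR k) by rewrite INRE; apply: subfield_nat.
have F_pos p : F (IZR (Z.pos p)) by rewrite IZRposE.
have F_Z u : F (IZR u).
  case: u => [|p|p] //; first exact: (subfield0 HF).
  by rewrite -Pos2Z.opp_pos opp_IZR; apply: (subfieldN HF).
rewrite /peval; elim: (exps _ _) => [|e l IHl] /=; first exact: (subfield0 HF).
apply: (subfieldD HF) => //; apply: (subfieldM HF).
  by apply: (subfieldM HF) => //; rewrite RinvE; apply: (subfieldV HF).
rewrite /monom; elim: xs e {IHl} xsF => [|x xs IHxs] [|d e] xsF /=;
  try exact: (subfield1 HF).
apply: (subfieldM HF); last by apply: IHxs => y yxs; apply: xsF; right.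
by rewrite RpowE; apply: (subfieldX HF); apply: xsF; left.
Qed.

Lemma subfield_in_field (F G : R -> Prop) y :
  is_subfield F -> (forall x, G x -> F x) -> in_field G y -> F y.
Proof.
move=> HF GF [xs [xsG [D [c1 [c2 [_ ->]]]]]].
have xsF x : In x xs -> F x by move=> xxs; apply: GF; move/Forall_forall: xsG; apply.
rewrite RdivE; apply: (subfieldM HF); last apply: (subfieldV HF);
  exact: subfield_peval.
Qed.

(** [Negz i] stands for [-(i + 1)], whence the shift in the numerator. *)
Definition Q_of_rat (q : rat) : Q :=
  Qmake (if numq q is Negz i then Z.opp (Z.of_nat i.+1) else Z.of_nat `|numq q|)
        (Pos.of_nat `|denq q|).

Lemma Q2R_of_rat q : Q2R (Q_of_rat q) = ratr q.
Proof.
rewrite /Q2R /Q_of_rat /ratr [Qden _]/= [Qnum _]/=; congr (_ * _).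
  case: (numq q) => i; first by rewrite -INR_IZR_INZ INRE.
  rewrite -[LHS]/(IZR (Z.opp (Z.of_nat i.+1))).
  by rewrite opp_IZR -INR_IZR_INZ INRE NegzE rmorphN.
rewrite RinvE; congr (_^-1).
rewrite IZRposE -Pos_to_natE INRE Nat2Pos.id; last first.
  by apply/eqP; rewrite absz_eq0 denq_eq0.
by rewrite -{2}(absz_denq q).
Qed.

Lemma size_exps m D : size (exps m D) = (D.+1 ^ m)%N.
Proof.
elim: m => // m IHm; rewrite expnSr -IHm.
rewrite -[exps m.+1 D]/(flat_map (fun e => List.map (cons^~ e) (List.seq 0 D.+1))
  (exps m D)).
elim: (exps m D) => // e l IHl; rewrite mulSn -IHl.
apply: etrans (size_cat (List.map (cons^~ e) (List.seq 0 D.+1)) (flat_map _ l)) _.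
congr (_ + _)%N.
exact (etrans (length_map (cons^~ e) (List.seq 0 D.+1)) (length_seq D.+1 0)).
Qed.

Lemma In_mem (T : eqType) (x : T) (l : seq T) : In x l <-> x \in l.
Proof.
elim: l => //= a l IHl; rewrite inE; split.
  by move=> [->|/IHl ->]; rewrite ?eqxx ?orbT.
by move=> /predU1P[->|/IHl]; [left | right].
Qed.

Lemma mem_exps m D (e : {ffun 'I_m -> 'I_D.+1}) :
  [seq val (e i) | i <- enum 'I_m] \in exps m D.
Proof.
apply/In_mem; elim: m e => [|m IHm] e; first by rewrite (size0nil (size_enum_ord 0)); left.
rewrite enum_ordSl map_cons -map_comp; apply/in_flat_map.
exists [seq val ([ffun i => e (lift ord0 i)] i) | i <- enum 'I_m].
split; first exact: IHm.
apply/in_map_iff; exists (val (e ord0)); split; last first.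
  by apply/in_seq; split; [exact: Nat.le_0_l | exact/ssrnat.ltP/ltn_ord].
by congr (_ :: _); apply: eq_map => i; rewrite /= ffunE.
Qed.

(** Exponent functions inject into [exps m D], and both sides have [D.+1 ^ m] elements; by counting,
    the list is a permutation of the image and has no repetition. *)
Lemma big_exps m D (F : seq nat -> R) :
  \sum_(e <- exps m D) F e =
  \sum_(e : {ffun 'I_m -> 'I_D.+1}) F [seq val (e i) | i <- enum 'I_m].
Proof.
pose g (e : {ffun 'I_m -> 'I_D.+1}) := [seq val (e i) | i <- enum 'I_m].
have g_inj : injective g.
  move=> e e' /eq_in_map ee'; apply/ffunP => i; apply: val_inj.
  by apply: ee'; rewrite mem_enum.
have uniq_g : uniq [seq g e | e <- enum {ffun 'I_m -> 'I_D.+1}].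
  by rewrite map_inj_uniq ?enum_uniq.
have sub_g : {subset [seq g e | e <- enum {ffun 'I_m -> 'I_D.+1}] <= exps m D}.
  by move=> _ /mapP[e _ ->]; apply: mem_exps.
have size_g : (size (exps m D) <= size [seq g e | e <- enum {ffun 'I_m -> 'I_D.+1}])%N.
  by rewrite size_exps size_map -cardE card_ffun !card_ord.
have [_ eq_g] := uniq_min_size uniq_g sub_g size_g.
rewrite (perm_big [seq g e | e <- enum {ffun 'I_m -> 'I_D.+1}]) /=.
  by rewrite big_map big_enum.
by apply: uniq_perm => //; apply: leq_size_uniq size_g.
Qed.

Lemma monom_ffun (xs : seq R) (e : 'I_(size xs) -> nat) :
  monom xs [seq e i | i <- enum 'I_(size xs)] = \prod_(i < size xs) xs`_i ^+ e i.
Proof.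
elim: xs e => [|x xs IHxs] e; first by rewrite big_ord0.
rewrite big_ord_recl -(IHxs (fun i => e (lift ord0 i))) [size _]/= enum_ordSl /=.
by rewrite /monom /= RpowE -map_comp.
Qed.

Lemma alg_indep_rat (xs : seq R) :
  alg_indep xs -> rat_alg_indep (fun i : 'I_(size xs) => xs`_i).
Proof.
move=> indxs E c c0 e.
(* On the lists in [exps], [inord] is exact and the default of [nth] is never reached. *)
pose C (l : seq nat) := Q_of_rat (c [ffun i => inord (nth 0%N l (val i))]).
have CE (f : {ffun 'I_(size xs) -> 'I_E.+1}) :
    C [seq val (f i) | i <- enum 'I_(size xs)] = Q_of_rat (c f).
  congr (Q_of_rat (c _)); apply/ffunP => i.
  rewrite ffunE (nth_map i) ?nth_ord_enum ?inord_val // size_enum_ord.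
  exact: ltn_ord.
have foldE l (F : seq nat -> R) : fold_right Rplus 0 (List.map F l) = \sum_(f <- l) F f.
  by elim: l => [|a l IHl]; rewrite ?big_nil // big_cons /= IHl.
have peval0 : peval xs E C = 0.
  rewrite -[RHS]c0 /peval foldE big_exps; apply: eq_bigr => e' _.
  by rewrite CE Q2R_of_rat monom_ffun.
have /Qeq_eqR := indxs E C peval0 _ (proj2 (In_mem _ _) (mem_exps e)).
rewrite CE Q2R_of_rat RMicromega.Q2R_0 => /eqP.
by rewrite fmorph_eq0 => /eqP.
Qed.

(** The field generated by [G] lies inside the subfield [rat_frac z], so [rat_frac_trdeg] applies to
    a transcendence basis. *)
Lemma is_trdeg_le (G : R -> Prop) t (I : finType) (z : I -> R) :
  is_trdeg G t -> (forall y, G y -> rat_frac z y) -> (t <= #|I|)%N.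
Proof.
move=> [[xs [<- [xsG indxs]]] _] Gz.
apply: (rat_frac_trdeg (z := z) _ (alg_indep_rat indxs)) => i.
apply: (subfield_in_field (rat_frac_subfield z) Gz).
by move/Forall_forall: xsG; apply; apply: In_seq_nth.
Qed.

(** * Transcendence degree of a slice, and the final inequality *)

Lemma slice_trdeg k (P : point -> Prop) t n N Q :
  is_slice k P N Q -> num_vertices Q n -> is_trdeg (vertex_coord k P) t ->
  exists r n', [/\ (r <= n')%N, (n' <= n)%N & (t <= r * (n' - r) + r * k)%N].
Proof.
move=> [kN [[S0 [S0N QE]] PE]] [l [ndl [<- lE]]] trP.
(* The irredundant generators are distinct vertices of [Q], so there are at most [n] of them; [n']
   will be their number. *)
have [S [SS0 ndS SE Sv]] := in_hull_irredundant S0.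
have QS0 : Q = in_hull S0.
  by apply: functional_extensionality_dep => x; apply: propext.
have szS : (size S <= length l)%N.
  by apply/ssrnat.leP/NoDup_incl_length => // s /Sv sv; apply/lE; rewrite QS0.
pose A : 'M[R]_(size S, k) := \matrix_(i, j) nth origin S i j.
pose B : 'M[R]_(size S, N - k) := \matrix_(i, j) nth origin S i (k + j)%N.
pose pt (w : 'rV[R]_(size S)) : point := fun j => \sum_i w 0 i * nth origin S i j.
have SN i : (i < size S)%N -> in_Rd N (nth origin S i).
  by move=> iS; move/Forall_forall: S0N; apply; apply/SS0/In_seq_nth.
have PW x : P x <-> exists2 w, slice_weight B w & x = pt w.
  split.
    move=> /PE[]; rewrite QS0 -SE => /in_hullE[w [w0 w1 xE]] xk.
    exists (\row_i w i); first split.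
    - by move=> i; rewrite mxE.
    - by rewrite -[RHS]w1; apply: eq_bigr => i _; rewrite mxE.
    - apply/rowP => j; rewrite !mxE -[RHS](xk (k + j)%N); last by lia.
      by rewrite xE; apply: eq_bigr => i _; rewrite !mxE.
    - apply: functional_extensionality_dep => j; rewrite xE.
      by apply: eq_bigr => i _; rewrite mxE.
  move=> [w [w0 w1 wB] ->]; apply/PE; split.
    by rewrite QS0 -SE; apply/in_hullE; exists (w 0).
  (* Coordinates from [N] on vanish for every generator; those between [k] and [N] vanish by
     [w *m B = 0]. *)
  move=> j /ssrnat.leP kj; have [jN|Nj] := ltnP j N; last first.
    by rewrite /pt big1 // => i _; rewrite SN ?mulr0 //; apply/ssrnat.leP.
  have jB : (j - k < N - k)%N by lia.
  have := congr1 (fun X : 'rV_ _ => X 0 (Ordinal jB)) wB; rewrite !mxE; apply: etrans.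
  by apply: eq_bigr => i _; rewrite mxE /= subnKC.
have ptA w j : (w *m A) 0 j = pt w j.
  by rewrite mxE; apply: eq_bigr => i _; rewrite mxE.
have ptk w i : slice_weight B w -> (k <= i)%N -> pt w i = 0.
  by move=> wP /ssrnat.leP ki; have /PE[_ ->] : P (pt w) by apply/PW; exists w.
have [r [I [z [rn cardI zP]]]] := slice_vertices_rat_frac A B.
exists r, (size S); split=> //; rewrite -cardI.
apply: (is_trdeg_le (z := z) trP) => _ [v [[Pv vext] [i [/ssrnat.ltP ik ->]]]].
have [w wP vw] := proj1 (PW v) Pv.
have := zP (\row_j v j) _ (Ordinal ik); rewrite mxE; apply; split.
  by exists w => //; apply/rowP => j; rewrite ptA mxE vw.
move=> w1 w2 s w1P w2P /andP[s0 s1] vE.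
have [|||w1v _] := vext (pt w1) (pt w2).
- by apply/PW; exists w1.
- by apply/PW; exists w2.
- exists s; split; first by split; apply/RltP.
  (* From index [k] on, all three points vanish; below [k] the identity is an entry of the row
     equation. *)
  move=> j; have [jk|kj] := ltnP j k; last first.
    by rewrite vw !ptk // !Rmult_0_r Rplus_0_r.
  have := congr1 (fun X : 'rV_ _ => X 0 (Ordinal jk)) vE; rewrite [in LHS]mxE => ->.
  by rewrite -[pt w1 j](ptA _ (Ordinal jk)) -[pt w2 j](ptA _ (Ordinal jk)) !mxE.
- by apply/rowP => j; rewrite ptA mxE w1v.
Qed.

Open Scope R_scope.

Theorem theorem2 (k : nat) (P : point -> Prop) (t n : nat) :
  is_polytope k P ->
  is_trdeg (vertex_coord k P) t ->
  is_ic k P n ->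
  INR n >= 2 * sqrt (INR t) - INR k.
Proof.
move=> _ trP [[N [Q [sl nv]]] _].
have [r [n' [rn' n'n tr]]] := slice_trdeg sl nv trP.
have le4t : (4 * t <= (n + k) * (n + k))%N.
  (* Writing [n' = r + d] gives [t <= r * (d + k)]; the arithmetic-geometric mean inequality for [r]
     and [d + k] bounds [4 * t] by [(n' + k) ^ 2]. *)
  have [d n'E] : exists d, n' = (r + d)%N by exists (n' - r)%N; rewrite subnKC.
  rewrite n'E addKn -mulnDr in tr; apply: (@leq_trans ((n' + k) * (n' + k))); last first.
    by rewrite leq_mul ?leq_add2r.
  by rewrite n'E -addnA mulnn (leq_trans _ (nat_AGM2 _ _)) // leq_mul2l.
have t0 := pos_INR t; have n0 := pos_INR n; have k0 := pos_INR k.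
have le4t' : 4 * INR t <= (INR n + INR k) * (INR n + INR k).
  have := le_INR _ _ (elimT ssrnat.leP le4t).
  by rewrite -!multE -!plusE !mult_INR !plus_INR INR_IZR_INZ.
have := sqrt_pos (INR t); have := sqrt_sqrt _ t0; Lra.nra.
Qed.
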